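(* The function $(x,\alpha)\mapsto\beta_x(\alpha)$ is (i) not lower semi-computable to within precision $|x|/3$, i.e., there is no lower semi-computable function $g(x,\alpha)$ with $\beta_x(\alpha)-|x|/3\le g(x,\alpha)\le\beta_x(\alpha)$ for all $x,\alpha$; and (ii) not upper semi-computable to within precision $|x|/\log^4|x|$, i.e., there is no upper semi-computable function $g(x,\alpha)$ with $\beta_x(\alpha)\le g(x,\alpha)\le\beta_x(\alpha)+|x|/\log^4|x|$ for all $x,\alpha$.
   Context: $K$ is prefix Kolmogorov complexity w.r.t. a fixed reference universal prefix machine. For a finite set $S$, $K(S)$ is the length of a shortest program listing $S$, $K(x\mid S)$ the complexity of $x$ given the list of $S$; for $x\in S$, $\delta(x\mid S)=\log|S|-K(x\mid S)$ (log base 2). $\beta_x(\alpha)=\min\{\delta(x\mid S): S\text{ finite},x\in S,K(S)\le\alpha\}$. A function $f$ is upper semi-computable if there is a total computable $\phi(z,t)$ with $\phi(z,t+1)\le\phi(z,t)$ and $\lim_{t\to\infty}\phi(z,t)=f(z)$; $f$ is lower semi-computable if $-f$ is upper semi-computable. *)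

(* Defs.v *)
From HB Require Import structures.
From mathcomp Require Import all_boot all_order all_algebra finmap.
From mathcomp Require Import boolp classical_sets reals topology normedtype.
From mathcomp Require Import sequences exp.
From Stdlib Require Cantor.
Set Implicit Arguments.
Unset Strict Implicit.
Unset Printing Implicit Defensive.
Import Order.TTheory GRing.Theory Num.Theory.
Import numFieldNormedType.Exports.

Local Open Scope ring_scope.
Local Open Scope classical_set_scope.

(* Partial recursive functions.  All functions are unary on [nat]; several
   arguments are packed with the Cantor pairing.  Since that pairing and its
   projections are primitive recursive, the programs below compute exactly
   Kleene's partial recursive functions. *)

Definition cpair (m n : nat) : nat := Cantor.to_nat (m, n).
Definition cfst (n : nat) : nat := (Cantor.of_nat n).1.
Definition csnd (n : nat) : nat := (Cantor.of_nat n).2.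

Inductive program : Type :=
  | PZero
  | PSucc
  | PFst
  | PSnd
  | PPair of program & program
  | PComp of program & program
  | PRec of program & program
  | PMu of program.

(* [computes c n m]: on input [n], [c] halts with output [m].
   - [PRec a b] is primitive recursion on inputs <x, k>:
       h 0 = a x,   h i.+1 = b <x, <i, h i>>,   output h k.
   - [PMu a] outputs the least m with a <n, m> = 0, all of
     a <n, 0>, ..., a <n, m-1> being defined. *)
Fixpoint computes (c : program) (n m : nat) : Prop :=
  match c with
  | PZero => m = 0%N
  | PSucc => m = n.+1
  | PFst => m = cfst n
  | PSnd => m = csnd n
  | PPair a b =>
      exists u v, [/\ computes a n u, computes b n v & m = cpair u v]
  | PComp a b => exists2 u, computes b n u & computes a u m
  | PRec a b =>
      exists h : nat -> nat,
        [/\ computes a (cfst n) (h 0%N),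
            forall i, (i < csnd n)%N ->
              computes b (cpair (cfst n) (cpair i (h i))) (h i.+1)
          & m = h (csnd n)]
  | PMu a =>
      computes a (cpair n m) 0 /\
      forall i, (i < m)%N -> exists v, computes a (cpair n i) v.+1
  end.

Definition bitstring := seq bool.

Definition enc_seq (s : seq nat) : nat :=
  foldr (fun a r => (cpair a r).+1) 0%N s.

Definition enc_str (x : bitstring) : nat := enc_seq (map nat_of_bool x).

(* A finite set is presented by the list of its elements in lexicographic
   order, so that "the list of S" depends on S only. *)
Definition listing (S : {fset bitstring}) : seq bitstring :=
  sort (fun x y : seqlexi bool => (x <= y)%O) (enum_fset S).

Definition enc_set (S : {fset bitstring}) : nat :=
  enc_seq (map enc_str (listing S)).

Definition enc_int (a : int) : nat :=
  match a with Posz n => n.*2 | Negz n => n.*2.+1 end.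

Definition enc_rat (q : rat) : nat := cpair (enc_int (numq q)) `|denq q|%N.

(* [c] as a machine reading the bit string [p], with auxiliary information [y]
   and output [z], both given by their codes. *)
Definition runs (c : program) (p : bitstring) (y z : nat) : Prop :=
  computes c (cpair (enc_str p) y) z.

Definition prefix_machine (c : program) : Prop :=
  forall (y : nat) (p q : bitstring) (z z' : nat),
    runs c p y z -> runs c q y z' -> prefix p q -> p = q.

Definition universal_prefix_machine (U : program) : Prop :=
  prefix_machine U /\
  forall V, prefix_machine V ->
    exists w : bitstring,
      forall p y z, runs U (w ++ p) y z <-> runs V p y z.

(* The minimum of [A] when it exists, and the junk value [x0] otherwise. *)
Definition min_of (d : Order.disp_t) (T : porderType d) (x0 : T) (A : set T)
    : T :=
  xget x0 [set m | A m /\ forall a, A a -> (m <= a)%O].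

(* Complexity of the object with code [z] given the object with code [y].
   When [U] is universal a program always exists. *)
Definition Kcode (U : program) (z y : nat) : nat :=
  min_of 0%N [set k | exists2 p : bitstring, runs U p y z & k = size p].

(* The code [0] is that of the empty list: no auxiliary information. *)
Definition Kset (U : program) (S : {fset bitstring}) : nat :=
  Kcode U (enc_set S) 0.

Definition Kcond (U : program) (x : bitstring) (S : {fset bitstring}) : nat :=
  Kcode U (enc_str x) (enc_set S).

Definition log2 (R : realType) (r : R) : R := ln r / ln 2.

Definition delta (R : realType) (U : program) (x : bitstring)
    (S : {fset bitstring}) : R :=
  log2 (#|` S|%fset)%:R - (Kcond U x S)%:R.

(* [S] competes in the minimum defining beta_x(alpha). *)
Definition admissible (U : program) (x : bitstring) (alpha : nat)
    (S : {fset bitstring}) : Prop :=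
  x \in S /\ (Kset U S <= alpha)%N.

(* Meaningful only when some [S] is admissible; only finitely many are, so the
   minimum is then attained. *)
Definition beta (R : realType) (U : program) (x : bitstring) (alpha : nat) : R :=
  min_of 0 [set delta R U x S | S in admissible U x alpha].

Definition beta_defined (U : program) (x : bitstring) (alpha : nat) : Prop :=
  exists S : {fset bitstring}, admissible U x alpha S.

Definition total_computable (phi : bitstring -> nat -> nat -> rat) : Prop :=
  exists c : program, forall x alpha t,
    computes c (cpair (enc_str x) (cpair alpha t)) (enc_rat (phi x alpha t)).

Definition upper_semicomputable (R : realType) (f : bitstring -> nat -> R)
    : Prop :=
  exists phi : bitstring -> nat -> nat -> rat,
    [/\ total_computable phi,
        forall x alpha t, phi x alpha t.+1 <= phi x alpha t
      & forall x alpha, (fun t => ratr (phi x alpha t) : R) @ \oo --> f x alpha].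

Definition lower_semicomputable (R : realType) (f : bitstring -> nat -> R)
    : Prop :=
  upper_semicomputable (fun x alpha => - f x alpha).

(* Main.v *)
Require Import Defs.
From mathcomp Require Import all_boot all_order all_algebra finmap.
From mathcomp Require Import boolp classical_sets reals topology normedtype.
From mathcomp Require Import sequences exp zify lra.
From Stdlib Require Cantor.
Import Order.TTheory GRing.Theory Num.Theory.

(** Take [n = 2^k] and [alpha = 2k], so that [k] has a description much shorter
    than [n].  Call a string [x] of length [n] covered if it lies in some [S]
    with [K(S) <= alpha] and [log |S| <= n - O(k)]; by counting, most strings
    are not.  With the slowest halting program of length at most [alpha] as
    advice, coveredness is decidable, so if some uncovered [x] satisfies a
    given semi-decidable property then there is one with [K(x) = O(k)], and
    for it [beta_x(alpha) >= n - O(k)].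

    (i) A good lower approximation [g] is thus positive at some [x] of length
    [n].  The first [x] at which this is discovered has [K({x}) <= alpha],
    hence [beta_x(alpha) <= 0].

    (ii) A good upper approximation [g] is below [n/2] at an uncovered [x] that
    is incompressible given the cube of all strings of length [n].  As
    [g < n/2] is semi-decidable, it also holds at an uncovered [x] with
    [K(x) = O(k)], where [beta_x(alpha) > n/2]. *)

Set Implicit Arguments.
Unset Strict Implicit.
Unset Printing Implicit Defensive.
Import numFieldNormedType.Exports.
Local Open Scope nat_scope.

(** * Computable functions between coded types *)

Lemma cfst_pair m n : cfst (cpair m n) = m.
Proof. by rewrite /cfst /cpair Cantor.cancel_of_to. Qed.

Lemma csnd_pair m n : csnd (cpair m n) = n.
Proof. by rewrite /csnd /cpair Cantor.cancel_of_to. Qed.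

Lemma cpair_eta n : cpair (cfst n) (csnd n) = n.
Proof. by rewrite /cpair /cfst /csnd -surjective_pairing Cantor.cancel_to_of. Qed.

Lemma cpair_inj m n m' n' : cpair m n = cpair m' n' -> m = m' /\ n = n'.
Proof.
by move=> e; rewrite -(cfst_pair m n) -{2}(csnd_pair m n) e cfst_pair csnd_pair.
Qed.

Lemma leq_cpair m n : n <= cpair m n.
Proof.
apply: leq_trans (leq_addr m n) _; apply/ssrnat.leP.
exact: Cantor.to_nat_non_decreasing.
Qed.

(* [Some] and [cons] are both coded by a successor, so that one case analysis
   on numbers serves options and lists alike. *)
Class Enc (A : Type) := enc : A -> nat.
#[export] Instance enc_nat : Enc nat := id.
#[export] Instance enc_bool : Enc bool := nat_of_bool.
#[export] Instance enc_prod A B {_ : Enc A} {_ : Enc B} : Enc (A * B) :=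
  fun p => cpair (enc p.1) (enc p.2).
#[export] Instance enc_list A {_ : Enc A} : Enc (seq A) :=
  fun s => enc_seq (map enc s).
#[export] Instance enc_option A {_ : Enc A} : Enc (option A) :=
  fun o => if o is Some a then (enc a).+1 else 0.

(** Nothing is required of the program on numbers that are not codes of elements of [A]; it may
    diverge there. *)
Definition computable A B {_ : Enc A} {_ : Enc B} (f : A -> B) :=
  exists c, forall a, computes c (enc a) (enc (f a)).

Definition PId := PPair PFst PSnd.

Lemma computes_id n : computes PId n n.
Proof. by exists (cfst n), (csnd n); rewrite cpair_eta. Qed.

Fixpoint PConst (m : nat) : program :=
  if m is m'.+1 then PComp PSucc (PConst m') else PZero.

Lemma computes_const m n : computes (PConst m) n m.
Proof. by elim: m => //= m IH; exists m. Qed.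

Section Closure.
Context {G A B : Type} {eG : Enc G} {eA : Enc A} {eB : Enc B}.

(** Serves maps that merely reread a number at another type, such as [cpair], [enc_str] and
    [dec_seq]. *)
Lemma comp_code (f : A -> B) : (forall a, enc (f a) = enc a) -> computable f.
Proof. by move=> e; exists PId => a; rewrite e; apply: computes_id. Qed.

Lemma comp_id : computable (fun a : A => a).
Proof. by exists PId => a; apply: computes_id. Qed.

End Closure.

Section Closure.
Context {G A B : Type} {eG : Enc G} {eA : Enc A} {eB : Enc B}.

Lemma comp_const (b : B) : computable (fun _ : G => b).
Proof. by exists (PConst (enc b)) => a; apply: computes_const. Qed.

Lemma comp_comp (f : A -> B) (a : G -> A) :
  computable f -> computable a -> computable (fun g => f (a g)).
Proof.
by move=> [c hc] [d hd]; exists (PComp c d) => g /=; exists (enc (a g)).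
Qed.

End Closure.

Section Closure.
Context {G A B : Type} {eG : Enc G} {eA : Enc A} {eB : Enc B}.

Lemma comp_fst (a : G -> A * B) : computable a -> computable (fun g => (a g).1).
Proof.
by apply: (comp_comp (f := fst)); exists PFst => -[x y] /=; rewrite cfst_pair.
Qed.

Lemma comp_snd (a : G -> A * B) : computable a -> computable (fun g => (a g).2).
Proof.
by apply: (comp_comp (f := snd)); exists PSnd => -[x y] /=; rewrite csnd_pair.
Qed.

Lemma comp_pair (a : G -> A) (b : G -> B) :
  computable a -> computable b -> computable (fun g => (a g, b g)).
Proof.
move=> [c hc] [d hd]; exists (PPair c d) => g /=.
by exists (enc (a g)), (enc (b g)).
Qed.

End Closure.

Section Closure.
Context {G A B : Type} {eG : Enc G} {eA : Enc A} {eB : Enc B}.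

Lemma comp_iteri (n : G -> nat) (f : G -> nat -> A -> A) (a : G -> A) :
  computable n -> computable (fun q : G * (nat * A) => f q.1 q.2.1 q.2.2) ->
  computable a ->
  computable (fun g => iteri (n g) (f g) (a g)).
Proof.
move=> [c hc] [d hd] [e he].
exists (PComp (PRec e d) (PPair PId c)) => g /=.
exists (cpair (enc g) (n g)).
  by exists (enc g), (n g); split; [apply: computes_id|apply: hc|].
exists (fun i => enc (iteri i (f g) (a g))); rewrite cfst_pair csnd_pair.
by split=> // i _; apply: (hd (g, (i, _))).
Qed.

End Closure.

Section Closure.
Context {G A B : Type} {eG : Enc G} {eA : Enc A} {eB : Enc B}.

(** Common source of the case analyses on numbers, options, lists and booleans: in each of them the
    second branch has a successor as code. That branch is a bare program [c], because it need only
    converge when [m] really is the predecessor of [z g]. *)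
Lemma comp_caseE (z : G -> nat) (r0 r : G -> A) c :
  computable z -> computable r0 -> (forall g, z g = 0 -> r g = r0 g) ->
  (forall g m, z g = m.+1 -> computes c (cpair (enc g) m) (enc (r g))) ->
  computable r.
Proof.
move=> hz [c0 h0] hr hc.
have [b hb] : computable (fun g => iteri (z g) (fun _ _ => 1) 0).
  by apply: comp_iteri; [|exact: comp_const|exact: comp_const].
have [p hp] : computable (fun g => iteri (z g) (fun i _ => i) 0).
  apply: comp_iteri => //; last exact: comp_const.
  exact/comp_fst/comp_snd/comp_id.
(* The recursion runs [z g != 0] times, hence [c] is only evaluated where it
   is known to converge. *)
exists (PComp (PRec c0 (PComp (PComp c (PPair PId p)) PFst)) (PPair PId b)) => g.
set k := iteri (z g) (fun _ _ => 1) 0; exists (cpair (enc g) k).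
  by exists (enc g), k; split; [apply: computes_id|apply: hb|].
exists (fun i => if i is _.+1 then enc (r g) else enc (r0 g)).
rewrite cfst_pair csnd_pair; split; [exact: h0| |]; last first.
  by rewrite /k; case e: (z g) => [|m] //=; rewrite hr.
move=> i; rewrite /k; case e: (z g) => [|m] //= _.
exists (enc g); first by rewrite cfst_pair.
exists (cpair (enc g) m); last exact: hc.
by exists (enc g), m; split; [apply: computes_id|have := hp g; rewrite e|].
Qed.

End Closure.

Section Closure.
Context {G A B : Type} {eG : Enc G} {eA : Enc A} {eB : Enc B}.

Lemma comp_natcase (z : G -> nat) (f : G -> nat -> A) (a : G -> A) :
  computable z -> computable (fun q : G * nat => f q.1 q.2) -> computable a ->
  computable (fun g => if z g is m.+1 then f g m else a g).
Proof.
move=> hz [c hc] ha; apply: (comp_caseE (z := z) (r0 := a) (c := c)) => //.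
  by move=> g ->.
by move=> g m e; rewrite e; apply: (hc (g, m)).
Qed.

Lemma comp_optcase (z : G -> option B) (f : G -> B -> A) (a : G -> A) :
  computable z -> computable (fun q : G * B => f q.1 q.2) -> computable a ->
  computable (fun g => if z g is Some m then f g m else a g).
Proof.
move=> hz [c hc] ha.
apply: (comp_caseE (z := fun g => enc (z g)) (r0 := a) (c := c)) => //.
- by move=> g; case: (z g).
by move=> g m; case: (z g) => // b [<-]; apply: (hc (g, b)).
Qed.

Lemma comp_seqcase (z : G -> seq B) (f : G -> B -> seq B -> A) (a : G -> A) :
  computable z -> computable (fun q : G * (B * seq B) => f q.1 q.2.1 q.2.2) ->
  computable a ->
  computable (fun g => if z g is b :: s then f g b s else a g).
Proof.
move=> hz [c hc] ha.
apply: (comp_caseE (z := fun g => enc (z g)) (r0 := a) (c := c)) => //.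
- by move=> g; case: (z g).
by move=> g m; case: (z g) => // b s [<-]; apply: (hc (g, (b, s))).
Qed.

Lemma comp_if (b : G -> bool) (x y : G -> A) :
  computable b -> computable x -> computable y ->
  computable (fun g => if b g then x g else y g).
Proof.
move=> hb [c hc] hy.
apply: (comp_caseE (z := fun g => b g : nat) (r0 := y) (c := PComp c PFst)) => //.
- by move=> g; case: (b g).
move=> g m; case: (b g) => // _.
by exists (enc g) => //=; rewrite cfst_pair.
Qed.

Lemma comp_Some (a : G -> A) : computable a -> computable (fun g => Some (a g)).
Proof. by move=> [c hc]; exists (PComp PSucc c) => g; exists (enc (a g)). Qed.

Lemma comp_cons (a : G -> A) (s : G -> seq A) :
  computable a -> computable s -> computable (fun g => a g :: s g).
Proof.
move=> ha hs; have [c hc] := comp_pair ha hs.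
by exists (PComp PSucc c) => g; exists (enc (a g, s g)).
Qed.

End Closure.

Lemma comp_and G {eG : Enc G} (x y : G -> bool) :
  computable x -> computable y -> computable (fun g => x g && y g).
Proof. by move=> hx hy; apply: comp_if => //; apply: comp_const. Qed.

Lemma comp_neg G {eG : Enc G} (x : G -> bool) :
  computable x -> computable (fun g => ~~ x g).
Proof. by move=> hx; apply: comp_if => //; apply: comp_const. Qed.

Lemma comp_or G {eG : Enc G} (x y : G -> bool) :
  computable x -> computable y -> computable (fun g => x g || y g).
Proof. by move=> hx hy; apply: comp_if => //; apply: comp_const. Qed.

(** * Arithmetic functions *)

Section Arith.
Context {G : Type} {eG : Enc G} (a b : G -> nat) (ha : computable a) (hb : computable b).

Lemma comp_S : computable (fun g => (a g).+1).
Proof. by apply: (comp_comp (f := S)) => //; exists PSucc. Qed.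

Lemma comp_cpair : computable (fun g => cpair (a g) (b g)).
Proof.
apply: (comp_comp (f := fun p : nat * nat => cpair p.1 p.2)
  (a := fun g => (a g, b g))); [exact: comp_code|exact: comp_pair].
Qed.

Lemma comp_cfst : computable (fun g => cfst (a g)).
Proof. by apply: (comp_comp (f := cfst)) => //; exists PFst. Qed.

Lemma comp_csnd : computable (fun g => csnd (a g)).
Proof. by apply: (comp_comp (f := csnd)) => //; exists PSnd. Qed.
End Arith.

Lemma comp_ext A B {eA : Enc A} {eB : Enc B} (f f' : A -> B) :
  f =1 f' -> computable f -> computable f'.
Proof. by move=> e [c hc]; exists c => a; rewrite -e. Qed.

Ltac comp1 :=
  lazymatch goal with
  | |- computable (fun x => x) => exact: comp_id
  | |- computable (fun _ => ?b) => exact: comp_const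
  | |- computable (fun x => (@?a x, @?b x)) => apply: (comp_pair (a := a) (b := b))
  | |- computable (fun x => fst (@?a x)) => apply: (comp_fst (a := a))
  | |- computable (fun x => snd (@?a x)) => apply: (comp_snd (a := a))
  | |- computable fst => exact: (comp_fst comp_id)
  | |- computable snd => exact: (comp_snd comp_id)
  | |- computable (fun x => S (@?a x)) => apply: (comp_S (a := a))
  | |- computable (fun x => cpair (@?a x) (@?b x)) => apply: (comp_cpair (a := a) (b := b))
  | |- computable (fun x => cfst (@?a x)) => apply: (comp_cfst (a := a))
  | |- computable (fun x => csnd (@?a x)) => apply: (comp_csnd (a := a))
  | |- computable (fun x => cons (@?a x) (@?b x)) => apply: (comp_cons (a := a) (s := b))
  | |- computable (fun x => Some (@?a x)) => apply: (comp_Some (a := a))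
  | |- computable (fun x => andb (@?a x) (@?b x)) => apply: (comp_and (x := a) (y := b))
  | |- computable (fun x => orb (@?a x) (@?b x)) => apply: (comp_or (x := a) (y := b))
  | |- computable (fun x => negb (@?a x)) => apply: (comp_neg (x := a))
  | |- computable (fun x => iteri _ _ _) => fail
  | |- computable (fun x => foldl _ _ _) => fail
  | |- _ => assumption || apply: comp_if
  end.

Section Arith.
Context {G : Type} {eG : Enc G} (a b : G -> nat) (ha : computable a) (hb : computable b).

Lemma comp_add : computable (fun g => a g + b g).
Proof.
apply: (comp_ext (f := fun g => iteri (b g) (fun _ r => r.+1) (a g))).
  by move=> g; elim: (b g) => [|n IH] /=; rewrite ?addn0 // IH addnS.
by apply: comp_iteri => //; repeat comp1.
Qed.

Lemma comp_pred : computable (fun g => (a g).-1).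
Proof.
apply: (comp_ext (f := fun g => if a g is m.+1 then m else 0)).
  by move=> g; case: (a g).
by apply: comp_natcase; repeat comp1.
Qed.
End Arith.

Section Arith.
Context {G : Type} {eG : Enc G} (a b : G -> nat) (ha : computable a) (hb : computable b).

Lemma comp_sub : computable (fun g => a g - b g).
Proof.
apply: (comp_ext (f := fun g => iteri (b g) (fun _ r => r.-1) (a g))).
  by move=> g; elim: (b g) => [|n IH] /=; rewrite ?subn0 // IH subnS.
by apply: comp_iteri => //; apply: comp_pred; repeat comp1.
Qed.

Lemma comp_mul : computable (fun g => a g * b g).
Proof.
apply: (comp_ext (f := fun g => iteri (b g) (fun _ r => r + a g) 0)).
  by move=> g; elim: (b g) => [|n IH] /=; rewrite ?muln0 // IH mulnS addnC.
apply: comp_iteri => //; last exact: comp_const.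
apply: comp_add; first by repeat comp1.
by apply: (comp_comp (a := fun q : G * (nat * nat) => q.1) ha); repeat comp1.
Qed.

Lemma comp_odd : computable (fun g => odd (a g)).
Proof.
apply: (comp_ext (f := fun g => iteri (a g) (fun _ r => ~~ r) false)).
  by move=> g; elim: (a g) => [|n IH] //=; rewrite IH.
by apply: comp_iteri => //; repeat comp1.
Qed.

Lemma comp_is0 : computable (fun g => a g == 0).
Proof.
apply: (comp_ext (f := fun g => if a g is m.+1 then false else true)).
  by move=> g; case: (a g).
by apply: comp_natcase; repeat comp1.
Qed.
End Arith.

Section Arith.
Context {G : Type} {eG : Enc G} (a b : G -> nat) (ha : computable a) (hb : computable b).

Lemma comp_leq : computable (fun g => a g <= b g).
Proof. exact/comp_is0/comp_sub. Qed.

Lemma comp_exp : computable (fun g => a g ^ b g).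
Proof.
apply: (comp_ext (f := fun g => iteri (b g) (fun _ r => r * a g) 1)).
  by move=> g; elim: (b g) => [|n IH] //=; rewrite IH expnSr.
apply: comp_iteri => //; last exact: comp_const.
apply: comp_mul; first by repeat comp1.
by apply: (comp_comp (a := fun q : G * (nat * nat) => q.1) ha); repeat comp1.
Qed.
End Arith.

Lemma comp_eqn G {eG : Enc G} (a b : G -> nat) :
  computable a -> computable b -> computable (fun g => a g == b g).
Proof.
move=> ha hb; apply: (comp_ext (f := fun g => (a g <= b g) && (b g <= a g))).
  by move=> g; rewrite eqn_leq.
by apply: comp_and; apply: comp_leq.
Qed.

Ltac comp2 :=
  lazymatch goal with
  | |- computable (fun x => addn (@?a x) (@?b x)) => apply: (comp_add (a := a) (b := b))
  | |- computable (fun x => muln (@?a x) (@?b x)) => apply: (comp_mul (a := a) (b := b))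
  | |- computable (fun x => subn (@?a x) (@?b x)) => apply: (comp_sub (a := a) (b := b))
  | |- computable (fun x => expn (@?a x) (@?b x)) => apply: (comp_exp (a := a) (b := b))
  | |- computable (fun x => leq (@?a x) (@?b x)) => apply: (comp_leq (a := a) (b := b))
  | |- computable (fun x => @eq_op _ (@?a x) (@?b x)) => apply: (comp_eqn (a := a) (b := b))
  | |- computable (fun x => odd (@?a x)) => apply: (comp_odd (a := a))
  | _ => comp1
  end.

(** * List functions *)

Section Lists.
Context {G A B : Type} {eG : Enc G} {eA : Enc A} {eB : Enc B}.

Lemma size_enc (s : seq A) : size s <= enc s.
Proof.
rewrite /enc /enc_list; elim: s => //= a s IH.
by rewrite ltnS (leq_trans IH) ?leq_cpair.
Qed.

(** The iterated state consists of the accumulator and the unread tail. By [size_enc] the code of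
    the list is a sufficient number of rounds, and rounds after the end of the list change
    nothing. *)
Lemma comp_foldl (f : G -> B -> A -> B) (b : G -> B) (s : G -> seq A) :
  computable (fun q : G * (B * A) => f q.1 q.2.1 q.2.2) -> computable b -> computable s ->
  computable (fun g => foldl (f g) (b g) (s g)).
Proof.
move=> hf hb hs.
pose step g (p : B * seq A) := if p.2 is a :: s then (f g p.1 a, s) else p.
apply: (comp_ext
  (f := fun g => (iteri (enc (s g)) (fun _ => step g) (b g, s g)).1)).
  move=> g; have {hs hb} := size_enc (s g).
  move: (s g) (b g) (enc _) => {s b} s b n.
  move=> le; rewrite (_ : iteri _ _ _ = (foldl (f g) b (take n s), drop n s)).
    by rewrite take_oversize.
  elim: n {le} => [|n IH] /=; first by rewrite take0 drop0.
  rewrite IH /step /=; have [lt|ge] := ltnP n (size s); last first.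
    by rewrite drop_oversize // !take_oversize ?drop_oversize // leqW.
  case: s lt {IH} => // a0 s lt.
  by rewrite (drop_nth a0 lt) (take_nth a0 lt) foldl_rcons.
apply: comp_fst; apply: comp_iteri; last by repeat comp1.
  by apply: (comp_comp (f := fun s : seq A => enc s : nat)) => //; apply: comp_code.
apply: comp_seqcase; [by repeat comp1| |by repeat comp1].
apply: comp_pair; last by repeat comp1.
apply: (comp_comp (a := fun q => (q.1.1, (q.1.2.2.1, q.2.1))) hf).
by repeat comp1.
Qed.
End Lists.

Section Lists.
Context {G A B : Type} {eG : Enc G} {eA : Enc A} {eB : Enc B}.

Lemma comp_rev (s : G -> seq A) : computable s -> computable (fun g => rev (s g)).
Proof.
move=> hs; apply: (comp_ext
  (f := fun g => foldl (fun (r : seq A) a => a :: r) [::] (s g))).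
  move=> g; rewrite -[RHS]cats0 -catrevE; move: [::].
  by elim: (s g) => //= a t IH r; rewrite IH.
by apply: comp_foldl; repeat comp2.
Qed.
End Lists.

Section Lists.
Context {G A B : Type} {eG : Enc G} {eA : Enc A} {eB : Enc B}.

Lemma comp_foldr (f : G -> A -> B -> B) (b : G -> B) (s : G -> seq A) :
  computable (fun q : G * (A * B) => f q.1 q.2.1 q.2.2) -> computable b -> computable s ->
  computable (fun g => foldr (f g) (b g) (s g)).
Proof.
move=> hf hb hs.
apply: (comp_ext
  (f := fun g => foldl (fun r a => f g a r) (b g) (rev (s g)))).
  by move=> g; rewrite foldl_rev.
apply: comp_foldl => //; last exact: comp_rev.
apply: (comp_comp (f := fun q => f q.1 q.2.1 q.2.2)
  (a := fun q : G * (B * A) => (q.1, (q.2.2, q.2.1))) hf).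
by repeat comp2.
Qed.
End Lists.

Section Lists.
Context {G A B : Type} {eG : Enc G} {eA : Enc A} {eB : Enc B}.

Lemma comp_map (f : G -> A -> B) (s : G -> seq A) :
  computable (fun q : G * A => f q.1 q.2) -> computable s ->
  computable (fun g => map (f g) (s g)).
Proof.
move=> hf hs; apply: (comp_foldr (f := fun g a r => f g a :: r)) => //;
  last exact: comp_const.
apply: comp_cons; last by repeat comp2.
by apply: (comp_comp (a := fun q : G * (A * seq B) => (q.1, q.2.1)) hf);
  repeat comp2.
Qed.

Lemma comp_has (f : G -> A -> bool) (s : G -> seq A) :
  computable (fun q : G * A => f q.1 q.2) -> computable s ->
  computable (fun g => has (f g) (s g)).
Proof.
move=> hf hs; apply: (comp_foldr (f := fun g a r => f g a || r)) => //;
  last exact: comp_const.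
apply: comp_or; last by repeat comp2.
by apply: (comp_comp (a := fun q : G * (A * bool) => (q.1, q.2.1)) hf);
  repeat comp2.
Qed.

Lemma comp_cat (s t : G -> seq A) :
  computable s -> computable t -> computable (fun g => s g ++ t g).
Proof.
move=> hs ht; apply: (comp_ext (f := fun g => foldr cons (t g) (s g))).
  by move=> g; elim: (s g) => //= a u ->.
by apply: comp_foldr => //; repeat comp2.
Qed.

Lemma comp_size (s : G -> seq A) : computable s -> computable (fun g => size (s g)).
Proof.
move=> hs; apply: (comp_ext (f := fun g => foldr (fun _ => succn) 0 (s g))).
  by move=> g; elim: (s g) => //= a u ->.
by apply: comp_foldr => //; repeat comp2.
Qed.

Lemma comp_drop (n : G -> nat) (s : G -> seq A) :
  computable n -> computable s -> computable (fun g => drop (n g) (s g)).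
Proof.
move=> hn hs.
apply: (comp_ext (f := fun g => iteri (n g) (fun _ => behead) (s g))).
  move=> g; elim: (n g) => /= [|m ->]; first by rewrite drop0.
  by rewrite -drop1 drop_drop add1n.
apply: comp_iteri => //; apply: comp_seqcase; by repeat comp2.
Qed.
End Lists.

(** * Step-bounded evaluation *)

(** A bounded search for a zero of [g], written as an iteration to be visibly computable: the
    counter sticks at the first argument where [g] is zero or undefined. *)
Definition count_pos (g : nat -> option nat) (t : nat) : nat :=
  iteri t (fun _ i => if g i is Some v then if v is _.+1 then i.+1 else i else i) 0.

Lemma count_posP g t : let i := count_pos g t in
  (forall j, j < i -> exists v, g j = Some v.+1) /\
  (i < t -> forall v, g i <> Some v.+1).
Proof.
rewrite /count_pos; elim: t => //= t [].
set i := iteri _ _ _ => below stop.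
have le : i <= t.
  by rewrite /i; elim: {i below stop} t => //= t IH; case: (g _) => [[|v]|]; lia.
case e: (g i) => [[|v]|] /=; try by split=> // _ v; rewrite e.
split=> [j|lt]; last by have /stop := lt; rewrite e => /(_ v).
by rewrite ltnS leq_eqVlt => /predU1P[->|/below//]; exists v.
Qed.

Lemma count_pos_eq g t m : m < t -> g m = Some 0 ->
  (forall j, j < m -> exists v, g j = Some v.+1) -> count_pos g t = m.
Proof.
move=> lt e pos; have [below stop] := count_posP g t.
case: (ltngtP (count_pos g t) m) => // h.
  by have [v /(stop (ltn_trans h lt))] := pos _ h.
by have [v] := below _ h; rewrite e.
Qed.

(** The fuel [t] limits only the searches of [PMu]; every other construct terminates by itself, so
    the evaluator is total. *)
Fixpoint ev (c : program) (t n : nat) : option nat :=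
  match c with
  | PZero => Some 0
  | PSucc => Some n.+1
  | PFst => Some (cfst n)
  | PSnd => Some (csnd n)
  | PPair a b =>
      if ev a t n is Some u then
        if ev b t n is Some v then Some (cpair u v) else None
      else None
  | PComp a b => if ev b t n is Some u then ev a t u else None
  | PRec a b =>
      iteri (csnd n) (fun i r =>
        if r is Some h then ev b t (cpair (cfst n) (cpair i h)) else None)
        (ev a t (cfst n))
  | PMu a =>
      let i := count_pos (fun i => ev a t (cpair n i)) t in
      if ev a t (cpair n i) is Some v then if v is _.+1 then None else Some i
      else None
  end.

Lemma comp_ev c : computable (fun q : nat * nat => ev c q.1 q.2).
Proof.
elim: c => [||||a IHa b IHb|a IHa b IHb|a IHa b IHb|a IHa] /=;
  try by repeat comp2.
- apply: comp_optcase => //; last by repeat comp2.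
  apply: comp_optcase; [|by repeat comp2..].
  by apply: (comp_comp (a := fun q : nat * nat * nat => q.1) IHb); repeat comp2.
- apply: comp_optcase => //; last by repeat comp2.
  by apply: (comp_comp (a := fun q : nat * nat * nat => (q.1.1, q.2)) IHa);
    repeat comp2.
- apply: comp_iteri; [by repeat comp2| |].
    apply: comp_optcase; [by repeat comp2| |by repeat comp2].
    apply: (comp_comp (a := fun q : nat * nat * (nat * option nat) * nat =>
      (q.1.1.1, cpair (cfst q.1.1.2) (cpair q.1.2.1 q.2))) IHb).
    by repeat comp2.
  by apply: (comp_comp (a := fun q : nat * nat => (q.1, cfst q.2)) IHa);
    repeat comp2.
have ci : computable (fun q : nat * nat =>
    count_pos (fun i => ev a q.1 (cpair q.2 i)) q.1).
  apply: comp_iteri; [by repeat comp2| |by repeat comp2].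
  apply: comp_optcase; [|apply: comp_natcase; by repeat comp2|by repeat comp2].
  apply: (comp_comp (a := fun q : nat * nat * (nat * nat) =>
    (q.1.1, cpair q.1.2 q.2.2)) IHa).
  by repeat comp2.
apply: comp_optcase; [| |by repeat comp2].
  apply: (comp_comp (a := fun q : nat * nat =>
    (q.1, cpair q.2 (count_pos (fun i => ev a q.1 (cpair q.2 i)) q.1))) IHa).
  by repeat comp2.
apply: comp_natcase; [by repeat comp2..|apply: comp_Some].
by apply: (comp_comp (a := fun q : nat * nat * nat => q.1) ci); repeat comp2.
Qed.

Lemma ev_mono c t t' n m : t <= t' -> ev c t n = Some m -> ev c t' n = Some m.
Proof.
(* Strictness is needed for [PMu]: the search with fuel [t] may return [t] itself, while
   [count_pos_eq] wants a zero strictly below the new bound [t']. *)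
rewrite leq_eqVlt => /predU1P[->//|lt]; have le := ltnW lt.
elim: c n m => [||||a IHa b IHb|a IHa b IHb|a IHa b IHb|a IHa] //= n m.
- case ea: (ev a t n) => [u|] //; case eb: (ev b t n) => [v|] // <-.
  by rewrite (IHa _ _ ea) (IHb _ _ eb).
- by case eb: (ev b t n) => [v|] // /IHa; rewrite (IHb _ _ eb).
- elim: (csnd n) m => [|k IH] m /=; first exact: IHa.
  by case e: (iteri _ _ _) => [h|] // /IHb; rewrite (IH _ e).
set g := fun i => ev a t _; set g' := fun i => ev a t' _.
have [below _] := count_posP g t.
have le_t : count_pos g t <= t.
  rewrite /count_pos; elim: (t) => //= k IH.
  by case: (g _) => [[|v]|]; lia.
case e: (ev a t _) => [[|v]|] // [<-].
rewrite (@count_pos_eq g' t' (count_pos g t)); last first.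
- by move=> j /below[v /IHa]; exists v.
- exact: IHa.
- exact: leq_ltn_trans le_t lt.
by rewrite (IHa _ _ e).
Qed.

Lemma ev_sound c t n m : ev c t n = Some m -> computes c n m.
Proof.
elim: c n m => [||||a IHa b IHb|a IHa b IHb|a IHa b IHb|a IHa] /= n m;
  try by move=> [].
- case ea: (ev a t n) => [u|] //; case eb: (ev b t n) => [v|] // [<-].
  by exists u, v; split; [exact: IHa|exact: IHb|].
- by case eb: (ev b t n) => [u|] // ea; exists u; [exact: IHb|exact: IHa].
- set st := fun i (r : option nat) => _.
  pose h i := iteri i st (ev a t (cfst n)).
  (* Once undefined, the iteration stays undefined; a defined final value therefore makes all
     intermediate values defined. *)
  have hS i k : i <= k -> h k <> None -> h i <> None.
    move=> le; rewrite -(subnK le); elim: (k - i) => //= d IH.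
    by move=> hn; apply: IH => e; apply: hn; rewrite /h /= -/(h _) e.
  rewrite -/(h (csnd n)) => hm.
  have hE i : i <= csnd n -> h i = Some (odflt 0 (h i)).
    move=> /hS; rewrite hm => hn; have : h i <> None by apply: hn.
    by case: (h i).
  exists (fun i => odflt 0 (h i)); split=> [|i lt|]; last by rewrite hm.
    by apply: IHa; rewrite -hE.
  by apply: IHb; rewrite -(hE i.+1 lt) /h /= -/(h i) hE // ltnW.
set g := fun i => _; have [below _] := count_posP g t.
case e: (ev a t _) => [[|v]|] // [<-]; split; first exact: IHa.
by move=> j /below[v ej]; exists v; apply: IHa.
Qed.

Lemma ev_complete c n m : computes c n m -> exists t, ev c t n = Some m.
Proof.
elim: c n m => [||||a IHa b IHb|a IHa b IHb|a IHa b IHb|a IHa] /= n m;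
  try by move=> ->; exists 0.
- case=> u [v [/IHa[t ea] /IHb[t' eb] ->]]; exists (maxn t t').
  by rewrite (ev_mono (leq_maxl _ _) ea) (ev_mono (leq_maxr _ _) eb).
- case=> u /IHb[t eb] /IHa[t' ea]; exists (maxn t t').
  by rewrite (ev_mono (leq_maxl _ _) eb) (ev_mono (leq_maxr _ _) ea).
- case=> h [h0 hS ->]; elim: (csnd n) hS => [|k IH] hS /=.
    by have [t e] := IHa _ _ h0; exists t.
  have [i lt|t e] := IH; first by apply: hS; rewrite leqW.
  have [t' e'] := IHb _ _ (hS k (leqnn _)); exists (maxn t t').
  have := ev_mono (c := PRec a b) (n := cpair (cfst n) k) (leq_maxl t t').
  rewrite /= cfst_pair csnd_pair => /(_ _ e) ->.
  exact: ev_mono (leq_maxr _ _) e'.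
case=> /IHa[t e] pos.
have [t' e'] : exists t', forall j, j < m -> exists v, ev a t' (cpair n j) = Some v.+1.
  elim: (m) pos => [|k IH] pos; first by exists 0.
  have [j lt|t1 e1] := IH; first by apply: pos; rewrite leqW.
  have [v /IHa[t2 e2]] := pos k (leqnn _); exists (maxn t1 t2) => j.
  rewrite ltnS leq_eqVlt => /predU1P[->|/e1[w e3]].
    by exists v; apply: ev_mono e2; apply: leq_maxr.
  by exists w; apply: ev_mono e3; apply: leq_maxl.
exists (maxn m.+1 (maxn t t')).
have {}e := ev_mono (t' := maxn m.+1 (maxn t t')) _ e.
rewrite (count_pos_eq (m := m)) ?e //; try by lia.
by move=> j /e'[v ej]; exists v; apply: ev_mono ej; lia.
Qed.

Lemma computes_inj c n m m' : computes c n m -> computes c n m' -> m = m'.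
Proof.
move=> /ev_complete[t e] /ev_complete[t' e'].
have := ev_mono (leq_maxl t t') e.
by rewrite (ev_mono (leq_maxr t t') e') => -[].
Qed.

(** * Searching with a prefix machine *)

(** A self-delimiting description of [(k, s)]: [k] in unary, then the length of [s] in unary, then
    [s]. Writing [k] in unary is affordable, since the strings of interest have length [2 ^ k]. *)
Definition frame (k : nat) (s : bitstring) : bitstring :=
  nseq k true ++ false :: nseq (size s) true ++ false :: s.

Definition ones (p : bitstring) : nat :=
  foldr (fun (b : bool) n => if b then n.+1 else 0) 0 p.

Definition frame_tail (p : bitstring) : bitstring := drop (ones p).+1 p.

Definition unframe (p : bitstring) : nat * bitstring :=
  (ones p, frame_tail (frame_tail p)).

Definition framed (p : bitstring) : bool :=
  size p == ones p + ((ones (frame_tail p)).*2).+2.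

Lemma ones_nseq n u : ones (nseq n true ++ false :: u) = n.
Proof. by elim: n => //= n ->. Qed.

Lemma frame_tail_nseq n u : frame_tail (nseq n true ++ false :: u) = u.
Proof.
by rewrite /frame_tail ones_nseq -cat_rcons drop_size_cat // size_rcons size_nseq.
Qed.

Lemma unframeK k s : unframe (frame k s) = (k, s).
Proof. by rewrite /unframe /frame ones_nseq !frame_tail_nseq. Qed.

Lemma size_frame k s : size (frame k s) = k + (size s).*2.+2.
Proof. by rewrite /frame size_cat /= size_cat /= !size_nseq; lia. Qed.

Lemma framed_frame k s : framed (frame k s).
Proof. by rewrite /framed size_frame /frame frame_tail_nseq !ones_nseq. Qed.

Lemma ones_cat p u : ones p < size p -> ones (p ++ u) = ones p.
Proof. by elim: p => //= -[] p IH //= /IH ->. Qed.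

(** The length equation forces both unary blocks of [p] to end inside [p]. An extension [q] has the
    same blocks, and these determine its length. *)
Lemma framed_prefix p q : framed p -> framed q -> prefix p q -> p = q.
Proof.
move=> /eqP hp /eqP + /prefixP[u e]; rewrite {}e.
have lt : ones p < size p by lia.
have tE : frame_tail (p ++ u) = frame_tail p ++ u.
  by rewrite /frame_tail ones_cat // drop_cat ifT // hp; lia.
have st : size (frame_tail p) = size p - (ones p).+1 by rewrite size_drop.
rewrite tE (ones_cat _ lt) ones_cat; last by rewrite st hp; lia.
rewrite size_cat -hp -[RHS]addn0 => /addnI/size0nil->.
by rewrite cats0.
Qed.

Lemma comp_ones G {eG : Enc G} (p : G -> bitstring) :
  computable p -> computable (fun g => ones (p g)).
Proof. by move=> hp; apply: comp_foldr => //; repeat comp2. Qed.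

Lemma comp_frame_tail G {eG : Enc G} (p : G -> bitstring) :
  computable p -> computable (fun g => frame_tail (p g)).
Proof. by move=> hp; apply: comp_drop => //; apply: comp_S; apply: comp_ones. Qed.

Lemma comp_unframe G {eG : Enc G} (p : G -> bitstring) :
  computable p -> computable (fun g => unframe (p g)).
Proof.
by move=> hp; apply: comp_pair; [exact: comp_ones|do 2 apply: comp_frame_tail].
Qed.

Lemma comp_framed G {eG : Enc G} (p : G -> bitstring) :
  computable p -> computable (fun g => framed (p g)).
Proof.
move=> hp; apply: (comp_ext (f := fun g => size (p g) ==
  ones (p g) + (ones (frame_tail (p g)) + ones (frame_tail (p g))).+2)).
  by move=> g; rewrite addnn.
have h1 := comp_ones hp; have h2 := comp_ones (comp_frame_tail hp).
have h3 := comp_size hp.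
by repeat comp2.
Qed.

Lemma enc_seq_inj : injective enc_seq.
Proof.
by elim=> [|a s IH] [|b t] //= [] /cpair_inj[-> /IH->].
Qed.

Lemma enc_str_inj : injective enc_str.
Proof. by move=> x y /enc_seq_inj/inj_map; apply=> -[] []. Qed.

Section Search.
Variables (U : program) (hU : universal_prefix_machine U).

(** All upper bounds on complexity come from here. The machine reads a frame of [(k, s)], searches
    for the least [j] accepted by [Q], and prints [h]. It never looks at [y], so one program serves
    all conditions. *)
Lemma search_machine B {eB : Enc B} (Q : nat * bitstring -> nat -> bool)
    (h : (nat * bitstring) * nat -> B) :
  computable (fun q : (nat * bitstring) * nat => Q q.1 q.2) -> computable h ->
  exists c, forall k s, (exists j, Q (k, s) j) ->
    exists2 j, Q (k, s) j & exists2 p, size p <= k + (size s).*2 + c &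
      forall y, runs U p y (enc (h ((k, s), j))).
Proof.
move=> hQ hh.
(* The test is negated because [PMu] looks for the value 0. *)
have [ct ht] : computable (fun q : (bitstring * nat) * nat =>
    ~~ (framed q.1.1 && Q (unframe q.1.1) q.2)).
  apply/comp_neg/comp_and; first by apply: comp_framed; repeat comp2.
  apply: (comp_comp (a := fun q : (bitstring * nat) * nat =>
    (unframe q.1.1, q.2)) hQ).
  by apply: comp_pair; [apply: comp_unframe|]; repeat comp2.
have [co ho] : computable (fun q : (bitstring * nat) * nat =>
    h (unframe q.1.1, q.2)).
  apply: (comp_comp (f := h)) => //.
  by apply: comp_pair; [apply: comp_unframe|]; repeat comp2.
pose V := PComp co (PPair PId (PMu ct)).
(* Outside frames the test is never 0, so the search diverges; this makes [V] a prefix machine. *)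
have halts p y z : runs V p y z -> framed p.
  case=> w [u [v [_ [e _] _]]] _.
  have := ht ((p, y), v) => /(computes_inj e).
  by case: (framed p).
have runsV p y j : framed p -> Q (unframe p) j ->
    (forall i, i < j -> ~~ Q (unframe p) i) ->
    runs V p y (enc (h (unframe p, j))).
  move=> fp qj min; exists (enc ((p, y), j)); last exact: (ho ((p, y), j)).
  exists (enc (p, y)), j; split=> //; first exact: computes_id.
  split=> [|i /min nq]; first by have := ht ((p, y), j); rewrite /= fp qj.
  by exists 0; have := ht ((p, y), i); rewrite /= fp (negbTE nq).
have [w hw] : exists w, forall p y z, runs U (w ++ p) y z <-> runs V p y z.
  apply: hU.2 => y p q z z' /halts fp /halts fq.
  exact: framed_prefix.
exists (size w).+2 => k s ex; have [j qj min] := ex_minnP ex.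
exists j => //; exists (w ++ frame k s); first by rewrite size_cat size_frame; lia.
move=> y; apply/hw; rewrite -(unframeK k s); apply: runsV.
- exact: framed_frame.
- by rewrite unframeK.
by move=> i lt; rewrite unframeK; apply/negP => /min; rewrite leqNgt lt.
Qed.

Lemma runs_inj p y z z' : runs U p y z -> runs U p y z' -> z = z'.
Proof. exact: computes_inj. Qed.

(** A trivial search with [z] itself as the unary parameter prints [z]. Hence [Kcode] is always a
    true minimum, never the junk value. *)
Lemma runs_surj z y : exists p, runs U p y z.
Proof.
have [||c hc] := @search_machine nat _ (fun _ _ => true) (fun q => q.1.1).
- exact: comp_const.
- by repeat comp2.
have [|j _ [p _ hp]] := hc z [::]; first by exists 0.
by exists p; apply: hp.
Qed.

Lemma Kcode_attained z y : exists2 p, runs U p y z & size p = Kcode U z y.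
Proof.
have [p0 hp0] := runs_surj z y.
have ex : exists n, `[< exists2 p, runs U p y z & n = size p >].
  by exists (size p0); apply/asboolP; exists p0.
have [n /asboolP[p hp en] min] := ex_minnP ex.
rewrite /Kcode /min_of; case: xgetP => [m _ [[q hq ->] _]|/(_ n)[]].
  by exists q.
split; first by exists p.
by move=> a [q hq ->]; apply: min; apply/asboolP; exists q.
Qed.

Lemma Kcode_le z y p : runs U p y z -> Kcode U z y <= size p.
Proof.
move=> hp; have [q hq eq] := Kcode_attained z y; move: eq.
have ex : exists n, `[< exists2 p, runs U p y z & n = size p >].
  by exists (size p); apply/asboolP; exists p.
have [n /asboolP[r hr en] min] := ex_minnP ex.
rewrite /Kcode /min_of; case: xgetP => [m _ [_ +] _|/(_ n)[]].
  by apply; exists p.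
split; first by exists r.
by move=> a [s hs ->]; apply: min; apply/asboolP; exists s.
Qed.

End Search.

(** * Enumerating strings *)

(** The order of generation is lexicographic, so that this list is exactly [listing (cube n)]. *)
Definition strings (n : nat) : seq bitstring :=
  iteri n (fun _ L => map (cons false) L ++ map (cons true) L) [:: [::]].

Definition short_strings (n : nat) : seq bitstring :=
  iteri n (fun i L => L ++ strings i) [::].

Lemma mem_strings n x : (x \in strings n) = (size x == n).
Proof.
elim: n x => [|n IH] [|b x] //=; rewrite mem_cat.
  by apply/negP => /orP[] /mapP[].
have inj c : injective (cons c : bitstring -> bitstring) by move=> u v [].
case: b; rewrite (mem_map (inj _)) IH eqSS.
  by rewrite orb_idl // => /mapP[].
by rewrite orb_idr // => /mapP[].
Qed.

Lemma size_strings n : size (strings n) = 2 ^ n.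
Proof. by elim: n => //= n IH; rewrite size_cat !size_map IH addnn -mul2n expnS. Qed.

Lemma uniq_strings n : uniq (strings n).
Proof.
elim: n => //= n IH; have inj c : injective (cons c : bitstring -> bitstring).
  by move=> u v [].
rewrite cat_uniq !map_inj_uniq // IH andbT /=.
by apply/hasPn => _ /mapP[x _ ->]; apply/mapP => -[].
Qed.

Lemma sorted_strings n :
  sorted (fun x y : seqlexi bool => (x <= y)%O) (strings n).
Proof.
rewrite sorted_pairwise; last exact: le_trans.
elim: n => //= n IH; rewrite pairwise_cat !pairwise_map.
apply/and3P; split.
- by apply/allrelP => _ _ /mapP[x _ ->] /mapP[y _ ->].
- by apply: sub_pairwise IH => x y /=; rewrite lexi_cons lexx.
- by apply: sub_pairwise IH => x y /=; rewrite lexi_cons lexx.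
Qed.

Lemma mem_short_strings n x : (x \in short_strings n) = (size x < n).
Proof.
elim: n => //= n IH; rewrite mem_cat IH mem_strings ltnS [RHS]leq_eqVlt.
by rewrite orbC.
Qed.

Lemma size_short_strings n : (size (short_strings n)).+1 = 2 ^ n.
Proof.
elim: n => //= n IH.
by rewrite size_cat size_strings -addSn IH addnn -mul2n expnS.
Qed.

Lemma comp_strings G {eG : Enc G} (n : G -> nat) :
  computable n -> computable (fun g => strings (n g)).
Proof.
move=> hn; apply: comp_iteri => //; last exact: comp_const.
by apply: comp_cat; apply: comp_map; repeat comp2.
Qed.

Lemma comp_short_strings G {eG : Enc G} (n : G -> nat) :
  computable n -> computable (fun g => short_strings (n g)).
Proof.
move=> hn; apply: comp_iteri => //; last exact: comp_const.
by apply: comp_cat; [|apply: comp_strings]; repeat comp2.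
Qed.

(** * Decoding, and listings of finite sets *)

Fixpoint dec_seq_rec (fuel n : nat) : seq nat :=
  if fuel is f.+1 then
    if n is m.+1 then cfst m :: dec_seq_rec f (csnd m) else [::]
  else [::].

Definition dec_seq (n : nat) : seq nat := dec_seq_rec n n.
(** Taking parities makes decoding total: entries other than 0 and 1 also yield some bit. *)
Definition dec_str (n : nat) : bitstring := map odd (dec_seq n).

Lemma dec_seqK : cancel dec_seq enc_seq.
Proof.
suff H f n : n <= f -> enc_seq (dec_seq_rec f n) = n by move=> n; apply: H.
elim: f n => [|f IH] [|m] //=; rewrite ltnS => le.
rewrite IH ?cpair_eta //; apply: leq_trans le.
by rewrite -{2}(cpair_eta m) leq_cpair.
Qed.

Lemma enc_seqK : cancel enc_seq dec_seq.
Proof. by move=> s; apply: enc_seq_inj; rewrite dec_seqK. Qed.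

Lemma enc_strK : cancel enc_str dec_str.
Proof.
move=> x; rewrite /dec_str /enc_str enc_seqK -map_comp -[RHS]map_id.
by apply: eq_map => -[].
Qed.

Lemma comp_dec_seq G {eG : Enc G} (n : G -> nat) :
  computable n -> computable (fun g => dec_seq (n g)).
Proof.
move=> hn; apply: (comp_comp (f := dec_seq)) => //; apply: comp_code => m.
by rewrite /enc /enc_list map_id dec_seqK.
Qed.

Lemma comp_dec_str G {eG : Enc G} (n : G -> nat) :
  computable n -> computable (fun g => dec_str (n g)).
Proof. by move=> hn; apply: comp_map; [repeat comp2|exact: comp_dec_seq]. Qed.

Lemma size_listing S : size (listing S) = #|` S|%fset.
Proof. by rewrite size_sort. Qed.

Lemma mem_listing S x : (x \in listing S) = (x \in S).
Proof. by rewrite mem_sort. Qed.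

Lemma enc_set_inj : injective enc_set.
Proof.
move=> S S' /enc_seq_inj/(inj_map enc_str_inj) e.
by apply/fsetP => x; rewrite -!mem_listing e.
Qed.

Definition cube (n : nat) : {fset bitstring} := [fset x in strings n]%fset.

Lemma mem_cube n x : (x \in cube n) = (size x == n).
Proof. by rewrite in_fset mem_strings. Qed.

Lemma listing_cube n : listing (cube n) = strings n.
Proof.
rewrite /listing -[RHS](sorted_sort (T := seqlexi bool) le_trans (sorted_strings n)).
apply/(perm_sort_leP (T := seqlexi bool)); apply: uniq_perm.
- exact: fset_uniq.
- exact: uniq_strings.
by move=> x; rewrite mem_strings -mem_cube.
Qed.

Lemma card_cube n : #|` cube n|%fset = 2 ^ n.
Proof. by rewrite -size_listing listing_cube size_strings. Qed.

Lemma listing1 x : listing [fset x]%fset = [:: x].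
Proof.
apply: perm_small_eq => //.
apply: uniq_perm => //; first by rewrite sort_uniq fset_uniq.
by move=> y; rewrite mem_listing !inE.
Qed.

(** * Simple strings outside all small simple sets *)

Section Covering.
Variables (U : program) (hU : universal_prefix_machine U).

Definition halt_by (T : nat) (p : bitstring) : option nat :=
  ev U T (cpair (enc_str p) 0).

(* Stage-[T] approximation of: [x] lies in some [S] with [K(S) <= 2k] and
   [|S| <= 2^(n - 2k - 3)], where [n = 2^k]. *)
Definition covered_by (T k : nat) (p x : bitstring) : bool :=
  if halt_by T p is Some z then
    (size (dec_seq z) * 2 ^ (2 * k + 3) <= 2 ^ 2 ^ k)
      && has (fun y => y == enc_str x) (dec_seq z)
  else false.

Definition covered (T k : nat) (x : bitstring) : bool :=
  has (fun p => covered_by T k p x) (short_strings (2 * k).+1).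

Lemma comp_enc_str G {eG : Enc G} (x : G -> bitstring) :
  computable x -> computable (fun g => enc_str (x g)).
Proof. by move=> hx; apply: (comp_comp (f := enc_str)) => //; apply: comp_code. Qed.

Lemma comp_halt_by G {eG : Enc G} (T : G -> nat) (p : G -> bitstring) :
  computable T -> computable p -> computable (fun g => halt_by (T g) (p g)).
Proof.
move=> hT hp; apply: (comp_comp
  (a := fun g => (T g, cpair (enc_str (p g)) 0)) (comp_ev U)).
have h := comp_enc_str hp.
by repeat comp2.
Qed.

Lemma comp_covered G {eG : Enc G} (T k : G -> nat) (x : G -> bitstring) :
  computable T -> computable k -> computable x ->
  computable (fun g => covered (T g) (k g) (x g)).
Proof.
move=> hT hk hx; apply: comp_has; last first.
  by apply: comp_short_strings; repeat comp2.
have hT1 : computable (fun q : G * bitstring => T q.1).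
  by apply: (comp_comp (a := fst) hT); repeat comp2.
have hz : computable (fun q : G * bitstring * nat => dec_seq q.2).
  by apply: comp_dec_seq; repeat comp2.
have hk1 : computable (fun q : G * bitstring * nat => k q.1.1).
  by apply: (comp_comp (a := fun q : G * bitstring * nat => q.1.1) hk); repeat comp2.
have hs := comp_size hz.
have hx1 : computable (fun q : G * bitstring * nat * nat => enc_str (x q.1.1.1)).
  apply: comp_enc_str.
  by apply: (comp_comp (a := fun q : G * bitstring * nat * nat => q.1.1.1) hx);
    repeat comp2.
apply: comp_optcase; last by repeat comp2.
  by apply: comp_halt_by => //; repeat comp2.
apply: comp_and; first by repeat comp2.
by apply: comp_has => //; repeat comp2.
Qed.

Lemma halt_byP T p z : halt_by T p = Some z -> runs U p 0 z.
Proof. exact: ev_sound. Qed.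

Lemma halt_by_mono T T' p : T <= T' -> halt_by T p -> halt_by T' p.
Proof.
move=> le; case e: (halt_by T p) => [z|] // _.
by rewrite /halt_by (ev_mono le e).
Qed.

Lemma halt_by_runs T p z : runs U p 0 z -> halt_by T p -> halt_by T p = Some z.
Proof.
by case e: (halt_by T p) => [w|] // h _; rewrite (runs_inj h (halt_byP e)).
Qed.

(** Slowness is expressed through stages: by any stage at which [p] has halted, every halting
    program of [L] has halted. The proof inserts the programs one at a time, keeping the slower of
    the new one and the previous slowest. *)
Lemma exists_slowest (L : seq bitstring) :
  (exists2 p, p \in L & exists T, halt_by T p) ->
  exists2 p, p \in L & (exists T, halt_by T p) /\
    forall T, halt_by T p ->
      forall q z, q \in L -> runs U q 0 z -> halt_by T q = Some z.
Proof.
move=> ex; suff [p pL [hp slow]] : exists2 p, p \in L & (exists T, halt_by T p) /\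
    forall T, halt_by T p ->
      forall q T', q \in L -> halt_by T' q -> halt_by T q.
  exists p => //; split=> // T hT q z qL hq.
  have [T' e] := ev_complete hq; apply: halt_by_runs => //.
  by apply: (slow T hT q T') => //; rewrite /halt_by e.
elim: L ex => [[] //|q L IH] ex.
have [[p pL [[T0 hp] slow]]|none] := pselect (exists2 p, p \in L &
  (exists T, halt_by T p) /\ forall T, halt_by T p ->
      forall q T', q \in L -> halt_by T' q -> halt_by T q); last first.
  (* If the tail has no slowest program, then by induction nothing in it halts, and [q] must be the
     halting one. *)
  have noL p T : p \in L -> ~ halt_by T p.
    by move=> pL hp; apply/none/IH; exists p => //; exists T.
  case: ex => p; rewrite inE => /predU1P[->|pL [T /noL]//] [T0 hT0].
  exists q; first exact: mem_head.
  split=> [|T hT r T']; first by exists T0.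
  by rewrite inE => /predU1P[->//|/noL nh /nh].
have [sl|] := pselect (forall T, halt_by T p -> forall T', halt_by T' q -> halt_by T q).
  exists p; first by rewrite inE pL orbT.
  split=> [|T hT r T']; first by exists T0.
  rewrite inE => /predU1P[->|rL]; [exact: sl|exact: slow hT r T' rL].
(* At some stage [T] the program [p] has halted and [q] has not. By monotonicity, whenever [q] has
   halted so has [p], and with it the rest of [L]. *)
move=> /existsNP[T /not_implyP[hT /existsNP[T1 /not_implyP[hq1 hqT]]]].
exists q; first exact: mem_head.
split=> [|T' hT' r T2]; first by exists T1.
rewrite inE => /predU1P[->//|rL]; apply: slow rL.
apply: halt_by_mono hT; rewrite leqNgt; apply/negP => /ltnW/halt_by_mono.
by move=> /(_ q hT').
Qed.

(** Let [n = 2 ^ k]. Fewer than [2 ^ (2k + 1)] programs each cover at most [2 ^ (n - 2k - 3)]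
    strings, at most a quarter of the cube in total. As [F] takes less than half, some string
    remains. *)
Lemma exists_uncovered T k (F : seq bitstring) :
  size F < 2 ^ (2 ^ k).-1 ->
  exists x, [/\ size x = 2 ^ k, ~~ covered T k x & x \notin F].
Proof.
set n := 2 ^ k => ltF; apply: contrapT => none.
pose out p := if halt_by T p is Some z then
  (if size (dec_seq z) * 2 ^ (2 * k + 3) <= 2 ^ n then map dec_str (dec_seq z)
   else [::]) else [::].
pose B := flatten (map out (short_strings (2 * k).+1)).
have sizeB : size B * 4 <= 2 ^ n.
  have : size B * 2 ^ (2 * k + 3) <= size (short_strings (2 * k).+1) * 2 ^ n.
    rewrite /B; elim: (short_strings _) => [|p L IH] //=.
    rewrite size_cat mulnDl mulSn leq_add // /out.
    case: (halt_by T p) => [z|] //=.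
    by case: ifP => // le; rewrite size_map.
  rewrite (_ : 2 * k + 3 = (2 * k).+1 + 2) ?expnD; last by lia.
  rewrite -size_short_strings; move: (size (short_strings _)) => s le.
  rewrite -(leq_pmul2l (ltn0Sn s)) mulnCA; apply: leq_trans le _.
  by rewrite leq_mul2r leqnSn orbT.
have sub : {subset strings n <= B ++ F}.
  move=> x; rewrite mem_strings => /eqP sx; rewrite mem_cat.
  apply/negPn/negP; rewrite negb_or => /andP[xB xF]; apply: none; exists x.
  split=> //; apply/negP => /hasP[p pL]; rewrite /covered_by.
  case e: (halt_by T p) => [z|] // /andP[le /hasP[y yz /eqP ey]].
  move/negP: xB; apply; apply/flattenP; exists (out p); first exact: map_f.
  rewrite /out e le; apply/mapP; exists y => //.
  by rewrite ey enc_strK.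
have := uniq_leq_size (uniq_strings n) sub.
rewrite size_strings size_cat.
have : 2 ^ n = 2 * 2 ^ n.-1 by rewrite -expnS prednK // expn_gt0.
move: sizeB ltF; move: (2 ^ n) (2 ^ n.-1) (size B) (size F) => N N1 b f; lia.
Qed.

(* The slowest halting program of size at most [2k] is advice from which all
   sets of complexity at most [2k] can be listed. *)
Lemma simple_uncovered (P : nat -> bitstring * nat -> bool) :
  computable (fun q : nat * (bitstring * nat) => P q.1 q.2) ->
  exists c, forall k S0, Kset U S0 <= 2 * k ->
    (forall T, exists x t, [/\ size x = 2 ^ k, ~~ covered T k x & P k (x, t)]) ->
    exists x t, [/\ size x = 2 ^ k, P k (x, t),
      forall S, admissible U x (2 * k) S ->
        2 ^ 2 ^ k < #|` S|%fset * 2 ^ (2 * k + 3)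
      & forall S, Kcond U x S <= 5 * k + c].
Proof.
move=> hP.
pose xj j := dec_str (cfst (csnd j)).
(* A candidate [j] packs a stage, a string and a witness for [P]; the advice [ks.2] must have halted
   by that stage. *)
pose Q (ks : nat * bitstring) j := [&& isSome (halt_by (cfst j) ks.2),
  size (xj j) == 2 ^ ks.1, ~~ covered (cfst j) ks.1 (xj j) &
  P ks.1 (xj j, csnd (csnd j))].
have hx G (eG : Enc G) (j : G -> nat) : computable j -> computable (fun g => xj (j g)).
  by move=> hj; apply: comp_dec_str; repeat comp2.
have hQ : computable (fun q : (nat * bitstring) * nat => Q q.1 q.2).
  have h1 : computable (fun q : (nat * bitstring) * nat => halt_by (cfst q.2) q.1.2).
    by apply: comp_halt_by; repeat comp2.
  have h2 : computable (fun q : (nat * bitstring) * nat => xj q.2).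
    by apply: hx; repeat comp2.
  have h3 := comp_size h2.
  have h4 : computable (fun q : (nat * bitstring) * nat =>
      covered (cfst q.2) q.1.1 (xj q.2)).
    by apply: comp_covered => //; repeat comp2.
  have h5 : computable (fun q : (nat * bitstring) * nat =>
      P q.1.1 (xj q.2, csnd (csnd q.2))).
    by apply: (comp_comp (a := fun q : (nat * bitstring) * nat =>
      (q.1.1, (xj q.2, csnd (csnd q.2)))) hP); repeat comp2.
  apply: comp_and; last by repeat comp2.
  by apply: comp_optcase => //; repeat comp2.
have [|c hc] := search_machine hU hQ (h := fun q => xj q.2).
  by apply: hx; repeat comp2.
exists c => k S0 hS0 ex.
(* The set [S0] only guarantees that some program of length at most [2k] halts. *)
have [p0 run0 size0] := Kcode_attained hU (enc_set S0) 0.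
have [T0 halt0] := ev_complete run0.
have [|s sL [[T hT] slow]] := @exists_slowest (short_strings (2 * k).+1).
  exists p0; last by exists T0; rewrite /halt_by halt0.
  by rewrite mem_short_strings size0.
have [x [t [sx ux Px]]] := ex T.
(* The stage [T] shows that the search succeeds. It may stop at another stage [cfst j], but [s] has
   halted there too, so coverage at that stage is final. *)
have [|j] := hc k s.
  exists (cpair T (cpair (enc_str x) t)).
  by rewrite /Q /xj !(cfst_pair, csnd_pair) enc_strK hT sx eqxx ux.
move=> /and4P[/= hT' /eqP sx' ux' Px'] [p size_p hp].
exists (xj j), (csnd (csnd j)); split=> //; last first.
  (* The frame of [k] and [s], with [s] of length at most [2k], costs [k + 2 * 2k = 5k] up to a
     constant. *)
  move=> S; apply: leq_trans (Kcode_le hU (hp _)) _.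
  move: sL size_p; rewrite mem_short_strings.
  by move: (size s) (size p) => m n; lia.
move=> S [xS KS]; rewrite ltnNge; apply: contra ux' => le.
(* A shortest program for a small [S] containing the string would have halted by the stage found,
   and the string would be covered. *)
have [q runq sizeq] := Kcode_attained hU (enc_set S) 0.
have qL : q \in short_strings (2 * k).+1 by rewrite mem_short_strings sizeq.
apply/hasP; exists q => //; rewrite /covered_by (slow _ hT' q _ qL runq).
rewrite enc_seqK size_map size_listing le /=.
by apply/hasP; exists (enc_str (xj j)) => //; rewrite map_f // mem_listing.
Qed.

Lemma Kset_cube : exists c, forall k, Kset U (cube (2 ^ k)) <= k + c.
Proof.
have [||c hc] := search_machine hU (Q := fun _ _ => true)
  (h := fun q => strings (2 ^ q.1.1)).
- exact: comp_const.
- by apply: comp_strings; repeat comp2.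
exists c => k; have [|j _ [p sp hp]] := hc k [::]; first by exists 0.
apply: leq_trans (Kcode_le hU _) (leq_trans sp _); last by rewrite addn0.
by have := hp 0; rewrite /enc_set listing_cube.
Qed.

(** The pair found first depends on [k] alone, so the unary [k] with empty advice describes the
    singleton. *)
Lemma Kset_singleton (P : nat -> bitstring * nat -> bool) :
  computable (fun q : nat * (bitstring * nat) => P q.1 q.2) ->
  exists c, forall k, (exists q, P k q) ->
    exists q, P k q /\ Kset U [fset q.1]%fset <= k + c.
Proof.
move=> hP; pose xj j := dec_str (cfst j).
have [||c hc] := search_machine hU (Q := fun ks j => P ks.1 (xj j, csnd j))
  (h := fun q => [:: xj q.2]).
- apply: (comp_comp (a := fun q : (nat * bitstring) * nat =>
      (q.1.1, (xj q.2, csnd q.2))) hP).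
  have h : computable (fun q : nat * bitstring * nat => xj q.2).
    by apply: comp_dec_str; repeat comp2.
  by repeat comp2.
- by apply: comp_cons; [apply: comp_dec_str|]; repeat comp2.
exists c => k [[x t] Px]; have [|j Pj [p sp hp]] := hc k [::].
  by exists (cpair (enc_str x) t); rewrite /xj cfst_pair csnd_pair enc_strK.
exists (xj j, csnd j); split=> //=.
apply: leq_trans (Kcode_le hU _) (leq_trans sp _); last by rewrite addn0.
by have := hp 0; rewrite /enc_set listing1.
Qed.

(** Here [F] collects the outputs, given the cube, of the [2 ^ (n - 1) - 1] programs shorter than
    [n - 1], where [n = 2 ^ k]; a program without a string output contributes the empty string by
    default. *)
Lemma exists_incompressible T k :
  exists x, [/\ size x = 2 ^ k, ~~ covered T k x &
    2 ^ k <= (Kcond U x (cube (2 ^ k))).+1].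
Proof.
set n := 2 ^ k; set y := enc_set (cube n).
pose out p := xget [::] [set x | runs U p y (enc_str x)]%classic.
have [|x [sx ux xF]] := @exists_uncovered T k (map out (short_strings n.-1)).
  by rewrite size_map -size_short_strings.
exists x; split=> //; rewrite leqNgt; apply: contra xF => lt.
have [p hp sp] := Kcode_attained hU (enc_str x) y.
apply/mapP; exists p.
  by rewrite mem_short_strings sp -/(Kcond U x (cube n)); lia.
rewrite /out; case: xgetP => [x' _ hx'|/(_ x)//].
exact/enc_str_inj/(runs_inj hp hx').
Qed.

End Covering.

(** * Bounds on beta *)

(** [enc_int] stores the sign in the parity, so the sign of a rational is decidable from its
    code. *)
Lemma odd_enc_rat (q : rat) : odd (cfst (enc_rat q)) = (q < 0)%R.
Proof.
by rewrite /enc_rat cfst_pair -numq_lt0; case: (numq q) => n /=;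
  rewrite ?odd_double // oddS odd_double.
Qed.

(** A numerator [a >= 0] has code [2a]; this is where the factor 2 comes from, and it makes the
    comparison with [N / 2] a comparison of naturals. *)
Lemma enc_rat_lt (q : rat) (N : nat) :
  odd (cfst (enc_rat q)) || (cfst (enc_rat q) < N * csnd (enc_rat q)) =
  (q * 2 < N%:R)%R.
Proof.
rewrite odd_enc_rat; have [q0|q0] /= := ltP q 0%R.
  by rewrite (lt_le_trans _ (ler0n _ _)) // pmulr_llt0.
rewrite /enc_rat cfst_pair csnd_pair.
have d0 : (0 < denq q)%R := denq_gt0 q.
have dQ : (0 < (denq q)%:~R :> rat)%R by rewrite ltr0z.
rewrite -{3}(divq_num_den q) mulrAC ltr_pdivrMr //.
have : (0 <= numq q)%R by rewrite numq_ge0.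
case: (numq q) => // n _; case: (denq q) d0 => // d _ /=.
rewrite -!pmulrn.
by rewrite -!natrM ltr_nat muln2.
Qed.

Section Beta.
Variables (R : realType) (U : program).
Local Open Scope ring_scope.
Local Open Scope classical_set_scope.

Lemma seq_min_exists (A : set R) (L : seq R) :
  (forall a, A a -> a \in L) -> A !=set0 ->
  exists m, A m /\ forall a, A a -> m <= a.
Proof.
elim: L A => [|b L IH] A AL [a Aa]; first by have := AL a Aa.
have [|none] := pselect ((A `&` [set a | a \in L]) !=set0).
  move=> /(IH (A `&` [set a | a \in L]))[x []//|m [[Am mL] min]].
  have [bm|mb] := ltP b m; last first.
    exists m; split=> // x Ax; have := AL x Ax.
    by rewrite inE => /predU1P[->//|xL]; apply: min.
  have [Ab|nAb] := pselect (A b).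
    exists b; split=> // x Ax; have := AL x Ax.
    rewrite inE => /predU1P[->//|xL]; apply: (le_trans (ltW bm)).
    exact: min.
  exists m; split=> // x Ax; have := AL x Ax.
  by rewrite inE => /predU1P[xb|xL]; [rewrite xb in Ax|apply: min].
have onlyb x : A x -> x = b.
  move=> Ax; have := AL x Ax; rewrite inE => /predU1P[//|xL].
  by case: none; exists x.
by exists a; split=> // x Ax; rewrite (onlyb a Aa) (onlyb x Ax).
Qed.

Hypothesis hU : universal_prefix_machine U.

(** Each admissible set is printed by a program of length at most [alpha], so only finitely many
    values compete and the minimum is not the junk value. *)
Lemma beta_attained x alpha : beta_defined U x alpha ->
  (exists2 S, admissible U x alpha S & beta R U x alpha = delta R U x S) /\
  forall S, admissible U x alpha S -> beta R U x alpha <= delta R U x S.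
Proof.
move=> [S0 hS0]; set A := [set delta R U x S | S in admissible U x alpha].
pose out p := xget fset0 [set S | runs U p 0 (enc_set S)].
have [||m [Am min]] := @seq_min_exists A
    (map (fun p => delta R U x (out p)) (short_strings alpha.+1)).
- move=> _ [S [xS KS] <-]; have [p hp sp] := Kcode_attained hU (enc_set S) 0.
  apply/mapP; exists p; first by rewrite mem_short_strings sp.
  rewrite /out; case: xgetP => [S' _ hS'|/(_ S)//].
  by rewrite (enc_set_inj (runs_inj hp hS')).
- by exists (delta R U x S0), S0.
rewrite /beta /min_of -/A; case: xgetP => [b _ [[S hS eb] minb]|/(_ m)[]//].
split; first by exists S.
by move=> S' hS'; apply: minb; exists S'.
Qed.

Lemma log2X n : log2 (2 ^+ n : R) = n%:R.
Proof.
have h : ln 2 != 0 :> R by rewrite gt_eqF // ln_gt0 // ltr1n.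
by rewrite /log2 lnXn // -[ln 2 *+ n]mulr_natl mulfK.
Qed.

Lemma log2_lt (x y : R) : 0 < x -> x < y -> log2 x < log2 y.
Proof.
move=> x0 xy; rewrite /log2 ltr_pM2r ?invr_gt0 ?ln_gt0 ?ltr1n //.
by rewrite ltr_ln // posrE // (lt_trans x0).
Qed.

Lemma log2M (x y : R) : 0 < x -> 0 < y -> log2 (x * y) = log2 x + log2 y.
Proof. by move=> x0 y0; rewrite /log2 lnM // mulrDl. Qed.

(** To be applied to the strings of [simple_uncovered]: in [delta], [log |S|] exceeds [n - m] and at
    most [c] is subtracted, for the set attaining the minimum. *)
Lemma beta_gt x alpha n m c : beta_defined U x alpha ->
  (forall S, admissible U x alpha S -> (2 ^ n < #|` S|%fset * 2 ^ m)%N) ->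
  (forall S, (Kcond U x S <= c)%N) ->
  n%:R - m%:R - c%:R < beta R U x alpha.
Proof.
move=> /beta_attained[[S hS ->] _] big small; rewrite /delta.
have lt := big S hS; have card0 : (0 < #|` S|%fset)%N.
  by rewrite lt0n; apply: contraTneq lt => ->; rewrite mul0n.
have : log2 (2 ^+ n : R) < log2 ((#|` S|%fset)%:R * 2 ^+ m).
  by apply: log2_lt; rewrite ?exprn_gt0 // -!natrX -natrM ltr_nat.
rewrite log2M ?ltr0n ?exprn_gt0 // !log2X.
by have := small S; rewrite -(ler_nat R); lra.
Qed.

Lemma delta_cube x n : delta R U x (cube n) = n%:R - (Kcond U x (cube n))%:R.
Proof. by rewrite /delta card_cube natrX log2X. Qed.

Lemma delta_singleton_le0 x : delta R U x [fset x]%fset <= 0.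
Proof. by rewrite /delta cardfs1 (log2X 0) sub0r oppr_le0 ler0n. Qed.

End Beta.

Section Semicomputable.
Variables (R : realType) (phi : bitstring -> nat -> nat -> rat).
Local Open Scope ring_scope.
Local Open Scope classical_set_scope.

Lemma comp_total_computable : total_computable phi ->
  computable (fun q : bitstring * (nat * nat) => enc_rat (phi q.1 q.2.1 q.2.2)).
Proof. by move=> [c hc]; exists c => -[x [a t]]; apply: hc. Qed.

Variables (x : bitstring) (alpha : nat) (l : R).
Hypothesis phi_lim : (fun t => ratr (phi x alpha t) : R) @ \oo --> l.

Lemma semicomputable_le t :
  (forall t, phi x alpha t.+1 <= phi x alpha t) -> l <= ratr (phi x alpha t).
Proof.
move=> dec; rewrite -(cvg_lim (@Rhausdorff R) phi_lim).
apply: (nonincreasing_cvgn_ge (u_ := fun t => ratr (phi x alpha t) : R)).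
  by apply/nonincreasing_seqP => n; rewrite ler_rat.
by apply/cvg_ex; exists l.
Qed.

(** Together with [semicomputable_le] this makes [l < r] equivalent to an event at a finite stage,
    which a search can detect. *)
Lemma semicomputable_lt (r : R) : l < r -> exists t, ratr (phi x alpha t) < r.
Proof.
move=> /(cvgr_lt _ phi_lim) [N _ h]; exists N.
by apply: (h N) => /=.
Qed.

End Semicomputable.

(** With [n = 2 ^ k], the last bound gives [n - (2k + 3) - (5k + c) >= n / 2], which serves both
    halves. The first turns [k + c] into at most [2k], and [1 < k] makes [k ^ 4] at least 16. *)
Lemma exp2_dominates c : exists k, [/\ c <= k, 1 < k & 14 * k + 6 + 2 * c <= 2 ^ k].
Proof.
have h d : 16 * (d + 7) <= 2 ^ (d + 7).
  by elim: d => [|d IH] //; rewrite addSn expnS; lia.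
by exists (c + 7); have := h c; split; lia.
Qed.

Lemma admissible_cube U k c x : (forall k, Kset U (cube (2 ^ k)) <= k + c) ->
  c <= k -> size x = 2 ^ k -> admissible U x (2 * k) (cube (2 ^ k)).
Proof.
move=> hc ck sx; split; first by rewrite mem_cube sx.
by apply: leq_trans (hc k) _; lia.
Qed.

(** * The two halves of the theorem *)

Section NotSemicomputable.
Variables (R : realType) (U : program) (hU : universal_prefix_machine U).
Local Open Scope ring_scope.

Lemma beta_not_lower_semicomputable (g : bitstring -> nat -> R) :
  lower_semicomputable g ->
  ~ forall (x : bitstring) (alpha : nat), beta_defined U x alpha ->
       beta R U x alpha - (size x)%:R / 3 <= g x alpha <= beta R U x alpha.
Proof.
move=> [phi [/comp_total_computable cphi dec lim]] approx.
have [c0 hc0] := Kset_cube hU.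
have [|c1 hc1] := simple_uncovered hU (P := fun _ _ => true).
  exact: comp_const.
(* As [phi] decreases to [- g], an odd code, that is a negative value, certifies that [g] is
   positive. *)
pose P (k : nat) (q : bitstring * nat) :=
  (size q.1 == 2 ^ k)%N && odd (cfst (enc_rat (phi q.1 (2 * k)%N q.2))).
have [|c2 hc2] := Kset_singleton hU (P := P).
  have h1 : computable (fun q : nat * (bitstring * nat) => size q.2.1).
    by apply: comp_size; repeat comp2.
  have h2 : computable (fun q : nat * (bitstring * nat) =>
      enc_rat (phi q.2.1 (2 * q.1)%N q.2.2)).
    by apply: (comp_comp (a := fun q : nat * (bitstring * nat) =>
      (q.2.1, ((2 * q.1)%N, q.2.2))) cphi); repeat comp2.
  by repeat comp2.
have [k [ck _ big]] := exp2_dominates (c0 + c1 + c2)%N.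
have cube_adm x : size x = (2 ^ k)%N -> admissible U x (2 * k) (cube (2 ^ k)).
  by apply: admissible_cube hc0 _; lia.
have [||x [_ [sx _ bigS smallK]]] := hc1 k (cube (2 ^ k)%N).
- by apply: leq_trans (hc0 k) _; lia.
- by move=> T; have [x [? ? _]] := exists_incompressible hU T k; exists x, 0%N.
have defx : beta_defined U x (2 * k) by exists (cube (2 ^ k)); apply: cube_adm.
have := beta_gt R hU defx bigS smallK.
have /andP[gx _] := approx x _ defx.
have bigR : (14 * k + 6 + 2 * (c0 + c1 + c2))%:R <= (2 ^ k)%:R :> R by rewrite ler_nat.
move: gx; rewrite sx; move: bigR; rewrite !(natrD, natrM) => bigR gx bx.
have gx0 : - g x (2 * k)%N < 0.
  have := ler0n R k; have := ler0n R c0; have := ler0n R c1; have := ler0n R c2.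
  lra.
have [t ht] := semicomputable_lt (lim x (2 * k)%N) gx0.
(* The string [x] only shows that the search ends. For the string [y] that it finds,
   [0 < g <= beta <= delta <= 0], the last [delta] being that of the singleton. *)
have [|[y s] [/andP[/eqP sy oy] Ky]] := hc2 k.
  by exists (x, t); rewrite /P sx eqxx odd_enc_rat /= -(ltrq0 R).
have admy : admissible U y (2 * k) [fset y]%fset.
  by split; [rewrite inE|apply: leq_trans Ky _; lia].
have defy : beta_defined U y (2 * k) by exists [fset y]%fset.
have := (beta_attained R hU defy).2 _ admy.
have /andP[_] := approx y _ defy.
have := semicomputable_le (lim y (2 * k)%N) s (dec y _).
have := delta_singleton_le0 R U y.
by move: oy; rewrite odd_enc_rat /= -(ltrq0 R); lra.
Qed.

Lemma beta_not_upper_semicomputable (g : bitstring -> nat -> R) :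
  upper_semicomputable g ->
  ~ forall (x : bitstring) (alpha : nat), beta_defined U x alpha ->
      (1 < size x)%N ->
      beta R U x alpha <= g x alpha
        <= beta R U x alpha + (size x)%:R / log2 ((size x)%:R : R) ^+ 4.
Proof.
move=> [phi [/comp_total_computable cphi dec lim]] approx.
have [c0 hc0] := Kset_cube hU.
pose P (k : nat) (q : bitstring * nat) := let e := enc_rat (phi q.1 (2 * k)%N q.2) in
  odd (cfst e) || (cfst e < 2 ^ k * csnd e)%N.
have [|c1 hc1] := simple_uncovered hU (P := P).
  have h2 : computable (fun q : nat * (bitstring * nat) =>
      enc_rat (phi q.2.1 (2 * q.1)%N q.2.2)).
    by apply: (comp_comp (a := fun q : nat * (bitstring * nat) =>
      (q.2.1, ((2 * q.1)%N, q.2.2))) cphi); repeat comp2.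
  by repeat comp2.
have PE k x t : P k (x, t) = (ratr (phi x (2 * k)%N t) * 2 < (2 ^ k)%:R :> R).
  by rewrite /P /= enc_rat_lt -(ltr_rat R) rmorphM /= !ratr_nat.
have [k [ck k1 big]] := exp2_dominates (c0 + c1)%N.
have cube_adm x : size x = (2 ^ k)%N -> admissible U x (2 * k) (cube (2 ^ k)).
  by apply: admissible_cube hc0 _; lia.
have n1 : (1 < 2 ^ k)%N by rewrite -{1}(expn0 2) ltn_exp2l // ltnW.
have bigR : (14 * k + 6 + 2 * (c0 + c1))%:R <= (2 ^ k)%:R :> R by rewrite ler_nat.
have k2 : 2 <= k%:R :> R by rewrite ler_nat.
have [c0R c1R] := (ler0n R c0, ler0n R c1).
move: bigR; rewrite !(natrD, natrM) => bigR.
have [||x [t [sx]]] := hc1 k (cube (2 ^ k)%N).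
- by apply: leq_trans (hc0 k) _; lia.
(* For an incompressible [x] the cube gives [beta <= 1], so that [g <= 1 + n / 16 < n / 2] with
   [n = 2 ^ k]; hence [P] holds at some uncovered string for every [T]. *)
- move=> T; have [x [sx ux Kx]] := exists_incompressible hU T k.
  have adm := cube_adm x sx; have defx : beta_defined U x (2 * k)
    by exists (cube (2 ^ k)).
  have := (beta_attained R hU defx).2 _ adm.
  have := approx x _ defx; rewrite sx => /(_ n1) /andP[_].
  rewrite {2}natrX log2X delta_cube.
  have : (2 ^ k)%:R <= (Kcond U x (cube (2 ^ k))).+1%:R :> R by rewrite ler_nat.
  rewrite -natr1 => Kn gx bx.
  (* The logarithm of the length is [k >= 2], so the allowed error is at most [n / 16]. *)
  have : (2 ^ k)%:R / k%:R ^+ 4 <= (2 ^ k)%:R / 16 :> R.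
    rewrite ler_wpM2l ?ler0n // lef_pV2 ?posrE ?exprn_gt0 //; last by lra.
    rewrite (_ : 16 = 2 ^+ 4); last by rewrite -natrX.
    by rewrite lerXn2r // nnegrE; lra.
  move=> le16; have gx2 : g x (2 * k)%N < (2 ^ k)%:R / 2 by lra.
  have [t ht] := semicomputable_lt (lim x (2 * k)%N) gx2.
  by exists x, t; split=> //; rewrite PE; lra.
rewrite PE => small bigS smallK.
(* The string found is uncovered and simple, which gives the contradiction
   [n / 2 < beta <= g <= phi < n / 2]. *)
have defx : beta_defined U x (2 * k) by exists (cube (2 ^ k)); apply: cube_adm.
have := beta_gt R hU defx bigS smallK.
have := approx x _ defx; rewrite sx => /(_ n1) /andP[+ _].
have := semicomputable_le (lim x (2 * k)%N) t (dec x _).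
rewrite !(natrD, natrM); lra.
Qed.
End NotSemicomputable.

Local Open Scope ring_scope.

Theorem mainTheorem16 (R : realType) (U : program)
    (hU : universal_prefix_machine U) :
  (~ exists g : bitstring -> nat -> R,
       lower_semicomputable g /\
       forall (x : bitstring) (alpha : nat), beta_defined U x alpha ->
         beta R U x alpha - (size x)%:R / 3 <= g x alpha <= beta R U x alpha)
  /\
  (~ exists g : bitstring -> nat -> R,
       upper_semicomputable g /\
       forall (x : bitstring) (alpha : nat), beta_defined U x alpha ->
         (1 < size x)%N ->
         beta R U x alpha <= g x alpha
           <= beta R U x alpha + (size x)%:R / log2 ((size x)%:R : R) ^+ 4).
Proof.
split=> -[g [hg approx]].
  exact: (beta_not_lower_semicomputable hU hg approx).
exact: (beta_not_upper_semicomputable hU hg approx).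
Qed.
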